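(* (In ZFC.) Let $r\geq3$ be an integer, $\kappa>0$ a cardinal, $\tau>0$ an ordinal, and $\lambda_\xi\geq r+1$ cardinals for $\xi<\tau$. If $\kappa\nrightarrow(\lambda_\xi)^r_{\xi<\tau}$, then \[ 2^\kappa\nrightarrow\big((\lambda_\xi+1)_{\xi<\tau},\underbrace{r+2,\dots,r+2}_{\eta(r)\text{ terms}}\big)^{r+1}, \] i.e. there is a colouring $g:\binom{2^\kappa}{r+1}\to\tau\oplus\eta(r)$ such that for no $\xi<\tau$ is there a set of cardinality $\lambda_\xi+1$ (cardinal addition) monochromatic in colour $\xi$, and for no $j<\eta(r)$ is there a set of cardinality $r+2$ monochromatic in colour $\tau\oplus j$. Here $\eta(r)=1$ if $r=3$, $\eta(r)=2$ if $r>3$ is even, $\eta(r)=3$ if $r>3$ is odd.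
   Context: Von Neumann ordinals are used; $\oplus$ denotes ordinal addition, $+$ cardinal addition, and $\binom{A}{r}$ the set of $r$-element subsets of $A$. For an integer $r\geq2$, an ordinal $\tau>0$, a cardinal $\kappa>0$ and cardinals $\lambda_\xi\geq r+1$ ($\xi<\tau$): a set $X\subset\kappa$ is monochromatic in colour $\xi$ under $f:\binom{\kappa}{r}\to\tau$ if $f(T)=\xi$ for all $T\in\binom{X}{r}$; $\kappa\nrightarrow(\lambda_\xi)^r_{\xi<\tau}$ means there is some $f:\binom{\kappa}{r}\to\tau$ such that there is no $\xi<\tau$ and $X\subset\kappa$ monochromatic in colour $\xi$ with $|X|=\lambda_\xi$. *)

(* Defs.v *)
From mathcomp Require Import all_boot.
From mathcomp Require Import boolp classical_sets functions cardinality.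
Set Implicit Arguments. Unset Strict Implicit. Unset Printing Implicit Defensive.
Local Open Scope classical_set_scope.
Local Open Scope card_scope.

(* Cardinals are modelled by types (a cardinal kappa = [set: K]); the power
   2^kappa is [set: set K]; "|X| = lambda" is X #= [set: L]. *)

Definition r_set (U : Type) (r : nat) (S : set U) : Prop := [set: 'I_r] #= S.

(* X is monochromatic in colour c under f (f only matters on r-sets) *)
Definition monochromatic (U C : Type) (r : nat) (f : set U -> C) (X : set U) (c : C)
  : Prop := forall S, S `<=` X -> r_set r S -> f S = c.

Definition neg_arrow (U C : Type) (r : nat) (lam : C -> Type) : Prop :=
  exists f : set U -> C,
    forall (c : C) (X : set U), X #= [set: lam c] -> ~ monochromatic r f X c.

Definition eta (r : nat) : nat :=
  if r == 3 then 1 else if odd r then 3 else 2.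

(* colour-size assignment of the conclusion: colour inl xi (= xi < tau) gets
   lambda_xi + 1 (cardinal addition, via option), colour inr j (= tau (+) j)
   gets r+2. *)
Definition concl_sizes (r : nat) (T : Type) (L : T -> Type) (eta_r : nat)
  (c : T + 'I_eta_r) : Type :=
  match c with inl xi => option (L xi) | inr _ => 'I_(r.+2) end.
Arguments concl_sizes r [T] L eta_r c.

(* Main.v *)
Require Import Defs.
From mathcomp Require Import all_boot zify.
From mathcomp Require Import boolp classical_sets functions cardinality wochoice.
Set Implicit Arguments. Unset Strict Implicit. Unset Printing Implicit Defensive.
Local Open Scope classical_set_scope.
Local Open Scope card_scope.

(* Well-order kappa.  A finite set S of subsets of kappa branches as a binary
   tree; let its levels be the first differences of its pairs.  If every branching
   has a single point on at least one side (the tree is a "comb"), the |S| - 1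
   branchings lie on different levels, and S gets the colour f(levels of S).  For
   a comb X of any size, sending a point to the last level at which it branches
   off is injective up to one point, and every r-subset of the image is the set
   of levels of an (r+1)-subset of X; so a monochromatic comb of size lambda+1
   yields a monochromatic set of size lambda for f.

   It remains to colour the trees with r+1 leaves so that combs are in the base
   class (coloured through f), and no non-comb with r+2 leaves has all its
   one-leaf deletions in the same one of the three classes: base, extra colour
   0, extra colour 1.  Then a set of size r+2 in one class is a comb, hence in
   the base class, and a set all of whose (r+1)-subsets are in the base class is
   a comb.  Two extra colours suffice for every r > 3; for r = 3 only one of
   them occurs. *)

(** * Binary trees, deletion of a leaf, extra colours of trees *)

Inductive tree := Leaf | Node of tree & tree.

Fixpoint leaves t := if t is Node l r then leaves l + leaves r else 1.

(* The first node on the way from the root with no leaf among its children; it is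
   [Leaf] exactly when the tree is a comb. *)
Fixpoint core t :=
  match t with
  | Node Leaf r => core r
  | Node l Leaf => core l
  | _ => t
  end.

Definition left_leaves t := if t is Node l _ then leaves l else 0.

(* The class alternates with the number of nodes above the core, and so changes when
   one of these is deleted while the core is kept.  This needs a deletion shrinking
   the core but leaving it a core, and there is none for the smallest core, with
   two cherries: it is therefore never in the base class, which is that of the
   combs obtained by deleting a leaf of it.  When the core is the root, deletions
   on its two sides give different parities of the number of leaves on the left. *)
Definition extra t : option bool :=
  let m := leaves (core t) in
  if (1 < m) && ((odd m == odd (leaves t)) || (m == 4))
  then Some (odd (left_leaves t)) else None.

(** The parent of the deleted leaf is contracted, as in the tree of a set of points from which one
    is removed. *)
Inductive del : tree -> tree -> Prop :=
| del_leafl r : del (Node Leaf r) r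
| del_leafr l : del (Node l Leaf) l
| del_left l l' r : del l l' -> del (Node l r) (Node l' r)
| del_right l r r' : del r r' -> del (Node l r) (Node l r').

Lemma leaves_gt0 t : 0 < leaves t.
Proof. by elim: t => //= l; case: (leaves l). Qed.

Lemma leaves_node t : 1 < leaves t -> exists l r, t = Node l r.
Proof. by case: t => // l r _; exists l, r. Qed.

Lemma del_leaves t t' : del t t' -> leaves t = (leaves t').+1.
Proof. by elim=> //= *; lia. Qed.

Lemma del_ex t : 1 < leaves t -> exists t', del t t'.
Proof.
elim: t => // l IHl r IHr _.
case: l IHl => [|l1 l2] IHl; first by exists r; constructor.
have [|l' dl] := IHl; first by have := leaves_gt0 l1; have := leaves_gt0 l2 => /=; lia.
by exists (Node l' r); constructor.
Qed.

Lemma core_node l r : 1 < leaves l -> 1 < leaves r -> core (Node l r) = Node l r.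
Proof. by case: l => // a b; case: r. Qed.

Lemma core_leafr l : core (Node l Leaf) = core l.
Proof. by case: l. Qed.

Lemma core_small t : leaves t < 4 -> core t = Leaf.
Proof.
elim: t => // l IHl r IHr.
case: l IHl => [|a b] IHl; first by move=> /= h; apply: IHr; lia.
case: r IHr => [|c d] IHr; first by move=> h; apply: IHl; move: h => /=; lia.
have := (leaves_gt0 a, leaves_gt0 b, leaves_gt0 c, leaves_gt0 d) => /= -[[[]]]; lia.
Qed.

Lemma core_leaves t : leaves (core t) <= leaves t.
Proof.
elim: t => // l IHl r IHr.
case: l IHl => [|a b] IHl; first by move=> /=; lia.
by case: r IHr => [|c d] IHr //; apply: leq_trans IHl _ => /=; lia.
Qed.

(** Delete a leaf hanging off the path to the core; or one on a side of the core with at least three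
    leaves; or one of a cherry that is a side of the core, the other side having at most three
    leaves and so being a comb. *)
Lemma core_del t : 1 < leaves (core t) ->
  [/\ leaves (core t) < leaves t -> exists2 t', del t t' & core t' = core t,
      4 < leaves (core t) ->
        exists2 t', del t t' & leaves (core t) = (leaves (core t')).+1 &
      leaves (core t) <= 5 -> exists2 t', del t t' & core t' = Leaf].
Proof.
elim: t => // l IHl r IHr.
have [l1|l1] := leqP (leaves l) 1.
  case: l l1 {IHl} => [_|a b]; last first.
    by have := (leaves_gt0 a, leaves_gt0 b) => /= -[]; lia.
  move=> /= /IHr [h1 h2 h3]; split=> h.
  - by exists r; first constructor.
  - by have [r' dr e] := h2 h; exists (Node Leaf r') => //; constructor.
  - by have [r' dr e] := h3 h; exists (Node Leaf r') => //; constructor.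
have [r1|r1] := leqP (leaves r) 1.
  case: r r1 {IHr} => [_|a b]; last first.
    by have := (leaves_gt0 a, leaves_gt0 b) => /= -[]; lia.
  rewrite core_leafr => /IHl [h1 h2 h3]; split=> h.
  - by exists l; first constructor.
  - by have [l' dl e] := h2 h; exists (Node l' Leaf); rewrite ?core_leafr //; constructor.
  - by have [l' dl e] := h3 h; exists (Node l' Leaf); rewrite ?core_leafr //; constructor.
rewrite core_node // => _; split=> [|/= h|/= h]; first by rewrite ltnn.
  have [l2|l2] := ltnP 2 (leaves l).
    have [l' dl] := del_ex l1; have e := del_leaves dl.
    exists (Node l' r); first by constructor.
    have l'1 : 1 < leaves l' by lia.
    by rewrite core_node //= e; lia.
  have [r' dr] := del_ex r1; have e := del_leaves dr.
  exists (Node l r'); first by constructor.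
  have r'1 : 1 < leaves r' by lia.
  by rewrite core_node //= e; lia.
have [l2|l2] := ltnP 2 (leaves l).
  have [r' dr] := del_ex r1; have e := del_leaves dr.
  exists (Node l r'); first by constructor.
  have -> : r' = Leaf.
    by case: r' e {dr} => // a b; have := (leaves_gt0 a, leaves_gt0 b) => /= -[]; lia.
  by rewrite core_leafr; apply: core_small; lia.
have [l' dl] := del_ex l1; have e := del_leaves dl.
exists (Node l' r); first by constructor.
have -> : l' = Leaf.
  by case: l' e {dl} => // a b; have := (leaves_gt0 a, leaves_gt0 b) => /= -[]; lia.
by rewrite /=; apply: core_small; lia.
Qed.

Lemma core_big t : 1 < leaves (core t) -> 3 < leaves (core t).
Proof.
elim: t => // -[|a b] IHl [|c d] IHr //=; try by [|apply: IHr|apply: IHl].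
by have := (leaves_gt0 a, leaves_gt0 b, leaves_gt0 c, leaves_gt0 d) => /= -[[[]]]; lia.
Qed.

Lemma extra_some t b : extra t = Some b ->
  b = odd (left_leaves t) /\ 1 < leaves (core t).
Proof. by rewrite /extra; case: ifP => // /andP[] ? _ [->]. Qed.

Lemma extra_leaf t : core t = Leaf -> extra t = None.
Proof. by rewrite /extra => ->. Qed.

Lemma extra_node l r : 1 < leaves l -> 1 < leaves r ->
  extra (Node l r) = Some (odd (leaves l)).
Proof.
move=> l1 r1; rewrite /extra core_node // eqxx /=; case: ifP => //.
by move: l1 r1; lia.
Qed.

(** With the core below the root, one deletion keeps the core, and the other shrinks it by one leaf
    or yields a comb. *)
Lemma extra_del t : 1 < leaves (core t) -> 4 < leaves t ->
  exists t1 t2, [/\ del t t1, del t t2 & extra t1 <> extra t2].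
Proof.
move=> tc t5; have [d1 d2 d3] := core_del tc.
have [ct|ct] := ltnP (leaves (core t)) (leaves t).
  have [t1 dt1 ct1] := d1 ct; have e1 := del_leaves dt1.
  have [c4|c4] := leqP (leaves (core t)) 4.
    have [t2 dt2 ct2] := d3 (leq_trans c4 (leqnSn _)).
    exists t1, t2; split=> //; rewrite (extra_leaf ct2) /extra ct1 tc /=.
    have -> : leaves (core t) == 4; last by rewrite orbT.
    by have := core_big tc; lia.
  have [p|p] := boolP (odd (leaves (core t)) == odd (leaves t)).
    have [t2 dt2 ct2] := d2 c4; have e2 := del_leaves dt2.
    exists t1, t2; split=> //; rewrite /extra ct1 tc.
    by case: ifP => h1; case: ifP => h2 //; lia.
  (* A core of five leaves would shrink to one of four, giving an extra colour as [t1] has; a comb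
     is produced instead. *)
  have [c5|c5] := leqP (leaves (core t)) 5.
    have [t2 dt2 ct2] := d3 c5.
    exists t1, t2; split=> //; rewrite (extra_leaf ct2) /extra ct1 tc /=.
    by case: ifP => h //; lia.
  have [t2 dt2 ct2] := d2 c4; have e2 := del_leaves dt2.
  exists t1, t2; split=> //; rewrite /extra ct1 tc.
  by case: ifP => h1; case: ifP => h2 //; lia.
have [l [r et]] : exists l r, t = Node l r by apply: leaves_node; lia.
have [l1 r1] : 1 < leaves l /\ 1 < leaves r.
  subst t; case: l tc t5 ct {d1 d2 d3} => [|a b] /=.
    by have := core_leaves r; lia.
  case: r => [|c d] /=.
    by have := core_leaves (Node a b) => /=; lia.
  have := (leaves_gt0 a, leaves_gt0 b, leaves_gt0 c, leaves_gt0 d) => /= -[[[]]]; lia.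
subst t; have [l' dl] := del_ex l1; have [r' dr] := del_ex r1.
have [el er] := (del_leaves dl, del_leaves dr).
exists (Node l' r), (Node l r'); split; try by constructor.
(* With at least five leaves in [t], one of the two trees keeps two leaves on each side and so has
   an extra colour; the parities of the left counts differ. *)
have [l2|l2] := ltnP 1 (leaves l').
  by rewrite extra_node // => /esym /extra_some [/=]; lia.
have r2 : 1 < leaves r' by move: t5 => /=; lia.
by rewrite (extra_node l1) // => /extra_some [/=]; lia.
Qed.

(** * Cardinalities of ranges and of finite sets *)

Lemma card_range_inj (P U : Type) (h : P -> U) :
  injective h -> range h #= [set: P].
Proof. by move=> hI; apply: inj_card_eq => x y _ _; apply: hI. Qed.

Lemma card_eq_range (P U : Type) (A : set U) :
  A #= [set: P] -> exists2 h : P -> U, injective h & range h = A.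
Proof.
rewrite card_eq_sym => /card_bijP [h [g hK gK]].
exists (fun p => val (h (SigSub (mem_set (I : [set: P] p))))).
  by move=> p q /val_inj /(can_inj hK) [].
apply/seteqP; split=> [_ [p _ <-]|x Ax]; first exact: set_valP.
exists (val (g (SigSub (mem_set Ax)))) => //.
set s := SigSub _; suff -> : s = g (SigSub (mem_set Ax)) by rewrite gK.
exact: val_inj.
Qed.

Lemma r_setU (U : Type) m n (A B : set U) : (forall x, A x -> ~ B x) ->
  r_set m A -> r_set n B -> r_set (m + n) (A `|` B).
Proof.
rewrite /r_set => AB; rewrite !(card_eq_sym [set: _]).
move=> /card_eq_range [h hI hA] /card_eq_range [k kI kB]; subst A B.
pose u (i : 'I_(m + n)) := match fintype.split i with inl a => h a | inr b => k b end.
have -> : range h `|` range k = range u.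
  apply/seteqP; split=> [x [[a _ <-]|[b _ <-]]|_ [i _ <-]].
  - by exists (lshift n a) => //; rewrite /u (unsplitK (inl a)).
  - by exists (rshift m b) => //; rewrite /u (unsplitK (inr b)).
  - by rewrite /u; case: (fintype.split i) => a; [left|right]; exists a.
apply: card_range_inj => i j; rewrite /u => e; apply: (can_inj splitK).
have d a b : h a <> k b by move=> ab; apply: (AB (h a)); [exists a|exists b].
case: (fintype.split i) (fintype.split j) e => a [] b e.
- by rewrite (hI _ _ e).
- by case: (d a b).
- by case: (d b a).
- by rewrite (kI _ _ e).
Qed.

Lemma r_set1 (U : Type) (x : U) : r_set 1 [set x].
Proof. by apply: card_esym; apply: card_eq_trans (card_set1) card_II. Qed.

(** * Strict well-orders *)

Definition strict_well_order (K : Type) (lt : K -> K -> Prop) :=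
  [/\ forall d, ~ lt d d,
      forall a b c, lt a b -> lt b c -> lt a c,
      forall a b, a <> b -> lt a b \/ lt b a &
      forall P : set K, P !=set0 -> exists2 d, P d & forall e, lt e d -> ~ P e].

Lemma strict_well_order_ex (K : Type) :
  exists lt : K -> K -> Prop, strict_well_order lt.
Proof.
have [R Rwo] := @well_ordering_principle {classic K}.
have min (P : set K) : P !=set0 -> exists2 z, P z & forall x, P x -> R z x.
  move=> [x Px]; have [|z [[zP zmin] _]] := Rwo (mem [set y : {classic K} | P y]).
    by exists x; apply/asboolP.
  by exists z; [exact/asboolP|move=> y Py; apply: zmin; apply/asboolP].
have wo : wo_chain R predT by move=> A _; apply: Rwo.
have refl x : R x x by apply: (wo_chain_reflexive wo).
have anti x y : R x y -> R y x -> x = y.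
  by move=> xy yx; apply: (wo_chain_antisymmetric wo) => //; rewrite xy yx.
exists (fun x y => ~ R y x); split=> [d|a b c nba ncb ca|a b ab|P P0].
- by apply.
(* Transitivity and totality are read off the least of the points involved. *)
- have [z zP zm] := min [set x | x = a \/ x = b \/ x = c] (ex_intro _ a (or_introl erefl)).
  have [za zb zc] : [/\ R z a, R z b & R z c] by split; apply: zm => /=; tauto.
  case: zP => [|[]] ez; subst z => //.
  by apply: ncb; rewrite -(anti a c zc ca).
- have [z zP zm] := min [set x | x = a \/ x = b] (ex_intro _ a (or_introl erefl)).
  have [za zb] : R z a /\ R z b by split; apply: zm => /=; tauto.
  case: zP => ez; subst z; [left|right] => h; apply: ab; exact: anti.
- have [z zP zm] := min P P0; exists z => // e ez Pe; apply: ez; exact: zm.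
Qed.

(** * First differences and the tree of a finite set of subsets *)

Section FirstDifference.
Variables (K : Type) (lt : K -> K -> Prop).
Hypothesis ltwo : strict_well_order lt.
Implicit Types (S A B X : set (set K)) (x y z : set K) (d e : K) (t : tree).

Definition agree d x y := forall e, lt e d -> x e = y e.
Definition fdiff d x y := agree d x y /\ x d <> y d.

(** The tree keeps the shape of the branching and forgets its levels. Only finite nonempty sets have
    one. *)
Inductive rep : set (set K) -> tree -> Prop :=
| rep_leaf x : rep [set x] Leaf
| rep_node d A B l r : rep A l -> rep B r ->
    (forall x y, (A `|` B) x -> (A `|` B) y -> agree d x y) ->
    (forall x, A x -> ~ x d) -> (forall x, B x -> x d) ->
    rep (A `|` B) (Node l r).

(** Being a non-comb, in a form that also makes sense for infinite sets, which have no tree. *)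
Definition fork X := exists d x1 x2 y1 y2,
  [/\ [/\ X x1, X x2, X y1 & X y2],
      x1 <> x2, y1 <> y2,
      [/\ agree d x1 x2, agree d x1 y1 & agree d x1 y2] &
      [/\ ~ x1 d, ~ x2 d, y1 d & y2 d]].

Lemma agree_sym d x y : agree d x y -> agree d y x.
Proof. by move=> h e /h. Qed.

Lemma agree_trans d x y z : agree d x y -> agree d y z -> agree d x z.
Proof. by move=> h k e ed; rewrite h // k. Qed.

Lemma fdiff_sym d x y : fdiff d x y -> fdiff d y x.
Proof. by move=> [h k]; split; [exact: agree_sym|exact/nesym]. Qed.

Lemma fdiff_ex x y : x <> y -> exists d, fdiff d x y.
Proof.
case: ltwo => _ _ _ min xy; have [|d dP dmin] := min [set d | x d <> y d].
  apply: contrapT => h; apply: xy; apply/funext => d; apply: contrapT => xd.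
  by apply: h; exists d.
by exists d; split=> // e ed; apply: contrapT; exact: dmin.
Qed.

Lemma lt_total d e : [\/ lt d e, d = e | lt e d].
Proof.
case: ltwo => _ _ tot _; have [->|/tot[]] := pselect (d = e);
by [apply: Or32|apply: Or31|apply: Or33].
Qed.

Lemma lt_trans a b c : lt a b -> lt b c -> lt a c.
Proof. by case: ltwo => _ + _ _; apply. Qed.

Lemma fdiff_uniq d e x y : fdiff d x y -> fdiff e x y -> d = e.
Proof.
by move=> [h k] [h' k']; have [/h'/k|//|/h/k'] := lt_total d e.
Qed.

Lemma rep_nonempty S t : rep S t -> S !=set0.
Proof. by elim=> [x|d A B l r _ [x Ax] *]; exists x => //; left. Qed.

Lemma rep_leaf_eq S x y : rep S Leaf -> S x -> S y -> x = y.
Proof. by move=> h; inversion h => -> ->. Qed.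

Lemma rep_node_inv S l r : rep S (Node l r) -> exists d A B,
  [/\ S = A `|` B, rep A l, rep B r,
      forall x y, S x -> S y -> agree d x y &
      (forall x, A x -> ~ x d) /\ (forall x, B x -> x d)].
Proof.
move=> h; inversion h as [|d A B l' r' rA rB ag Ad Bd]; subst.
by exists d, A, B.
Qed.

(** The root level is the first one at which points of [S] disagree, and the values there determine
    the two sides. *)
Lemma rep_uniq S t t' : rep S t -> rep S t' -> t = t'.
Proof.
move=> h; elim: h t' => [x|d A B l r rA IHA rB IHB ag Ad Bd] t'.
  case: t' => // l r /rep_node_inv [d [A [B [e /rep_nonempty [a Aa]]]]].
  move=> /rep_nonempty [b Bb] _ [Ad Bd].
  have ax : [set x] a by rewrite e; left.
  have bx : [set x] b by rewrite e; right.
  by case: (Ad a Aa); rewrite ax -bx; apply: Bd.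
have [[a Aa] [b Bb]] := (rep_nonempty rA, rep_nonempty rB).
have [Sa Sb] : (A `|` B) a /\ (A `|` B) b by split; [left|right].
case: t' => [/rep_leaf_eq /(_ Sa Sb) e|l' r' /rep_node_inv].
  by case: (Ad a Aa); rewrite e; apply: Bd.
move=> [d' [A' [B' [e rA' rB' ag' [Ad' Bd']]]]].
have [a' Aa'] := rep_nonempty rA'; have [b' Bb'] := rep_nonempty rB'.
have [Sa' Sb'] : (A `|` B) a' /\ (A `|` B) b' by rewrite e; split; [left|right].
have ed : d = d'.
  have [dd|//|dd] := lt_total d d'.
    by case: (Ad a Aa); rewrite (ag' a b Sa Sb d dd); apply: Bd.
  by case: (Ad' a' Aa'); rewrite (ag a' b' Sa' Sb' d' dd); apply: Bd'.
subst d'.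
have splitE (C D C' D' : set (set K)) :
    C `|` D = C' `|` D' -> (forall x, C x -> ~ x d) -> (forall x, D x -> x d) ->
    (forall x, C' x -> ~ x d) -> (forall x, D' x -> x d) -> C `<=` C' /\ D `<=` D'.
  move=> CD Cd Dd C'd D'd; split=> x xC.
    have : (C' `|` D') x by rewrite -CD; left.
    by case=> // /D'd /Cd; case.
  have : (C' `|` D') x by rewrite -CD; right.
  by case=> // /C'd; case; apply: Dd.
have [? ?] := splitE _ _ _ _ e Ad Bd Ad' Bd'.
have [? ?] := splitE _ _ _ _ (esym e) Ad' Bd' Ad Bd.
have eA : A = A' by apply/seteqP.
have eB : B = B' by apply/seteqP.
by subst A' B'; rewrite (IHA _ rA') (IHB _ rB').
Qed.

Lemma rep_disjoint d A B : (forall x, A x -> ~ x d) -> (forall x, B x -> x d) ->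
  forall x, A x -> ~ B x.
Proof. by move=> Ad Bd x /Ad xd /Bd. Qed.

Lemma rep_card S t : rep S t -> r_set (leaves t) S.
Proof.
elim=> [x|d A B l r _ IHA _ IHB _ Ad Bd]; first exact: r_set1.
exact: r_setU (rep_disjoint Ad Bd) IHA IHB.
Qed.

Lemma rep_del t t' S : del t t' -> rep S t -> exists2 S', S' `<=` S & rep S' t'.
Proof.
move=> dt; elim: dt S => [r|l|l l' r _ IH|l r r' _ IH] S /rep_node_inv
  [d [A [B [-> rA rB ag [Ad Bd]]]]].
- by exists B => // x; right.
- by exists A => // x; left.
- have [A' AA' rA'] := IH _ rA; exists (A' `|` B); first exact: setSU.
  apply: (rep_node (d := d)) => // [x y xA yA|x /AA' /Ad //].
  by apply: ag; [move: xA|move: yA]; apply: setSU.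
- have [B' BB' rB'] := IH _ rB; exists (A `|` B'); first exact: setUS.
  apply: (rep_node (d := d)) => // [x y xA yA|x /BB' /Bd //].
  by apply: ag; [move: xA|move: yA]; apply: setUS.
Qed.

(** All of [S] still agrees at [e], so [x] becomes a leaf child of a new root. *)
Lemma rep_join S t x e : rep S t ->
  (forall y z, S y -> S z -> agree e y z /\ y e = z e) ->
  (forall y, S y -> fdiff e x y) ->
  exists2 t', rep (x |` S) t' & leaves t' = (leaves t).+1.
Proof.
move=> rS Se xS; have [y0 Sy0] := rep_nonempty rS.
have ag y z : (x |` S) y -> (x |` S) z -> agree e y z.
  move=> [->|Sy] [->|Sz]; [by []| | |by case: (Se y z Sy Sz)].
  - by case: (xS _ Sz).
  - by apply: agree_sym; case: (xS _ Sy).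
have [xe|xe] := pselect (x e); last first.
  exists (Node Leaf t) => //; apply: (rep_node (d := e)) => //.
  - exact: rep_leaf.
  - by move=> _ ->.
  - move=> y /xS [_ h]; apply: contrapT => ye; apply: h; apply/propext; tauto.
exists (Node t Leaf); last by rewrite /= addn1.
rewrite setUC in ag *; apply: (rep_node (d := e)) => //.
- exact: rep_leaf.
- move=> y /xS [_ h] ye; apply: h; apply/propext; tauto.
- by move=> _ ->.
Qed.

(** Either [x] leaves before the root level [d] and a new root is formed, or it goes down the side
    given by its value at [d]. *)
Lemma rep_insert S t x : rep S t -> ~ S x ->
  exists2 t', rep (x |` S) t' & leaves t' = (leaves t).+1.
Proof.
move=> rS; elim: rS x => {S t} [y|d A B l r rA IHA rB IHB ag Ad Bd] x xS.
  have [e xye] : exists e, fdiff e x y by apply: fdiff_ex => xy; apply: xS.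
  by apply: (rep_join (e := e)); [exact: rep_leaf|move=> _ _ -> ->|move=> _ ->].
have [a Aa] := rep_nonempty rA; have Sa : (A `|` B) a by left.
have [[e ed xae]|nxe] := pselect (exists2 e, lt e d & fdiff e x a).
  apply: (rep_join (e := e)) => [|y z Sy Sz|y Sy].
  - exact: rep_node rA rB ag Ad Bd.
  - have yz := ag y z Sy Sz; split=> [f fe|]; last exact: yz.
    by apply: yz; apply: lt_trans ed.
  - have ya := ag a y Sa Sy; case: xae => h k.
    split=> [f fe|]; last by rewrite -ya.
    by rewrite h // ya //; apply: lt_trans ed.
have xa : agree d x a.
  have [->//|/fdiff_ex [e xae]] := pselect (x = a).
  have [ed|ed|ed] := lt_total e d.
  - by case: nxe; exists e.
  - by subst e; case: xae.
  - by move=> f fd; case: xae => + _; apply; apply: lt_trans ed.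
have ag' y z : (x |` (A `|` B)) y -> (x |` (A `|` B)) z -> agree d y z.
  have xS' y' : (A `|` B) y' -> agree d x y' by move=> h; apply: agree_trans xa (ag _ _ _ h).
  move=> [->|Sy] [->|Sz]; [by []| exact: xS'| |exact: ag].
  by apply: agree_sym; apply: xS'.
have [xd|xd] := pselect (x d).
  have [|r' rr' er'] := IHB x; first by move=> Bx; apply: xS; right.
  exists (Node l r'); last by rewrite /= er' addnS.
  rewrite setUCA in ag' *; apply: (rep_node (d := d)) => // y [->//|]; exact: Bd.
have [|l' rl' el'] := IHA x; first by move=> Ax; apply: xS; left.
exists (Node l' r); last by rewrite /= el'.
rewrite setUA in ag' *; apply: (rep_node (d := d)) => // y [->//|]; exact: Ad.
Qed.

Lemma rep_grow X S t n : rep S t -> S `<=` X -> leaves t <= n ->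
  [set: 'I_n] #<= X ->
  exists Y u, [/\ S `<=` Y, Y `<=` X, rep Y u & leaves u = n].
Proof.
move=> + + tn nX; move: {2}(n - leaves t) (erefl (n - leaves t)) => k.
elim: k S t tn => [|k IH] S t tn ek rS SX.
  by exists S, t; split=> //; lia.
have [x Xx Sx] : exists2 x, X x & ~ S x.
  apply: contrapT => h; have XS : X `<=` S.
    by move=> x Xx; apply: contrapT => Sx; apply: h; exists x.
  have : [set: 'I_n] #<= [set: 'I_(leaves t)].
    apply: card_le_trans nX (card_le_trans (subset_card_le XS) _).
    by have := rep_card rS; rewrite /r_set card_eq_sym => /card_eqPle [].
  rewrite -(card_le_eql card_II) -(card_le_eqr card_II) card_le_II; lia.
have [t' rt' et'] := rep_insert rS Sx.
have [|||Y [u [h1 h2 h3 h4]]] := IH _ _ _ _ rt'; rewrite ?et'; try lia.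
  by move=> y [->|/SX].
by exists Y, u; split=> // y Sy; apply: h1; right.
Qed.

Lemma rep_core_fork S t : rep S t -> 1 < leaves (core t) -> fork S.
Proof.
elim=> {S t} // d A B l r rA IHA rB IHB ag Ad Bd.
have sub C : C `<=` A `|` B -> fork C -> fork (A `|` B).
  move=> CAB [e [x1 [x2 [y1 [y2 [[h1 h2 h3 h4] ? ? ? ?]]]]]].
  by exists e, x1, x2, y1, y2; split=> //; split; apply: CAB.
have two C a b : rep C (Node a b) -> exists x y, [/\ C x, C y & x <> y].
  move=> /rep_node_inv [e [C1 [C2 [-> /rep_nonempty [x x1] /rep_nonempty [y y2] _]]]].
  move=> [h k]; exists x, y; split; [by left|by right|move=> xy].
  by apply: (h x x1); rewrite xy; apply: k.
case: l rA IHA => [|a b] rA IHA; first by move=> /= /IHB; apply: sub => x; right.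
case: r rB IHB => [|a' b'] rB IHB; first by move=> /= /IHA; apply: sub => x; left.
move=> _; have [x1 [x2 [h1 h2 h3]]] := two _ _ _ rA.
have [y1 [y2 [k1 k2 k3]]] := two _ _ _ rB.
exists d, x1, x2, y1, y2; split=> //.
- by split; [left|left|right|right].
- by split; apply: ag; by [left|right].
- by split; [exact: Ad|exact: Ad|exact: Bd|exact: Bd].
Qed.

(** The level of the fork cannot precede that of the root; equality puts two points on each side of
    the root, and a later level puts all four on the same side. *)
Lemma rep_fork_core S t : rep S t -> fork S -> 1 < leaves (core t).
Proof.
elim=> {S t} [x|d A B l r rA IHA rB IHB ag Ad Bd].
  by move=> [d [x1 [x2 [y1 [y2 [[-> ->]]]]]]].
move=> [e [x1 [x2 [y1 [y2 [[h1 h2 h3 h4] nx ny [a1 a2 a3] [x1e x2e y1e y2e]]]]]]].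
have core_l : 1 < leaves (core l) -> 1 < leaves (core (Node l r)).
  case: l {rA IHA} => // a b; case: r {rB IHB} => // a' b' _ /=.
  by have := (leaves_gt0 a, leaves_gt0 b) => -[]; lia.
have core_r : 1 < leaves (core r) -> 1 < leaves (core (Node l r)).
  case: l {rA IHA core_l} => // a b; case: r {rB IHB} => // a' b' _ /=.
  by have := (leaves_gt0 a, leaves_gt0 b) => -[]; lia.
have [ed|ed|ed] := lt_total e d.
- by case: x1e; rewrite (ag x1 y1 h1 h3 e ed).
- subst e.
  have side x : (A `|` B) x -> (x d -> B x) /\ (~ x d -> A x).
    by move=> [] h; split=> // xd; [case: (Ad x h)|case: xd; apply: Bd].
  have Ax1 : A x1 by apply (side x1 h1).
  have Ax2 : A x2 by apply (side x2 h2).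
  have By1 : B y1 by apply (side y1 h3).
  have By2 : B y2 by apply (side y2 h4).
  case: l rA {IHA core_l core_r} => [rA|a b rA].
    by case: nx; apply: rep_leaf_eq rA Ax1 Ax2.
  case: r rB {IHB} => [rB|a' b' rB]; first by case: ny; apply: rep_leaf_eq rB By1 By2.
  by move=> /=; have := (leaves_gt0 a, leaves_gt0 b) => -[]; lia.
- have same : [/\ x1 d = x2 d, x1 d = y1 d & x1 d = y2 d].
    by split; [exact: a1|exact: a2|exact: a3].
  case: same => e2 e3 e4; have [xd|xd] := pselect (x1 d).
    have inB x : (A `|` B) x -> x1 d = x d -> B x.
      by move=> [/Ad xnd|//] xx; case: xnd; rewrite -xx.
    by apply/core_r/IHB; exists e, x1, x2, y1, y2; split=> //; split; apply: inB.
  have inA x : (A `|` B) x -> x1 d = x d -> A x.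
    by move=> [//|/Bd xnd] xx; case: xd; rewrite xx.
  by apply/core_l/IHA; exists e, x1, x2, y1, y2; split=> //; split; apply: inA.
Qed.

Lemma fork_rep4 X : fork X -> exists S t,
  [/\ fork S, S `<=` X, rep S t & leaves t = 4].
Proof.
move=> [d [x1 [x2 [y1 [y2 [[h1 h2 h3 h4] nx ny [a1 a2 a3] [x1d x2d y1d y2d]]]]]]].
have pair (x y : set K) : x <> y -> exists2 t, rep (x |` [set y]) t & leaves t = 2.
  by move=> xy; have [] := rep_insert (rep_leaf y) xy; move=> t; exists t.
have [[t rt et] [u ru eu]] := (pair _ _ nx, pair _ _ ny).
exists ((x1 |` [set x2]) `|` (y1 |` [set y2])), (Node t u); split.
- exists d, x1, x2, y1, y2; split=> //.
  by split; [left; left|left; right|right; left|right; right].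
- by move=> x [[->|->]|[->|->]].
- have ag1 x : ((x1 |` [set x2]) `|` (y1 |` [set y2])) x -> agree d x1 x.
    by move=> [[->|->]|[->|->]].
  apply: (rep_node (d := d)) => // [x y /ag1 hx /ag1 hy|x [->|->] //|x [->|->] //].
  exact: agree_trans (agree_sym hx) hy.
- by rewrite /= et eu.
Qed.

End FirstDifference.

(** * Numbering the extra colours *)

(** The core has at least four leaves, so the root has two on each side; hence a single extra colour
    is enough for r = 3. *)
Lemma extra_leaves4 t b : leaves t = 4 -> extra t = Some b -> b = false.
Proof.
move=> t4 /extra_some [-> /core_big]; case: t t4 => // l r /= lr.
case: l lr => [|a a'] lr; first by have := core_leaves r; move: lr => /=; lia.
case: r lr => [|b' b''] lr.
  by have := core_leaves (Node a a'); move: lr => /=; lia.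
have := (leaves_gt0 a, leaves_gt0 a', leaves_gt0 b', leaves_gt0 b'').
by move: lr => /= ? [[[]]]; lia.
Qed.

Lemma extra_index_proof r (b : bool) : b && (r != 3) < eta r.
Proof. by rewrite /eta; case: eqP => // _; case: b; case: (odd r). Qed.

Definition extra_index r b : 'I_(eta r) := Ordinal (extra_index_proof r b).

Lemma extra_index_inj r t t' b b' : leaves t = r.+1 -> leaves t' = r.+1 ->
  extra t = Some b -> extra t' = Some b' ->
  extra_index r b = extra_index r b' -> b = b'.
Proof.
move=> tr t'r tb t'b' /(congr1 val) /=; have [r3|_] := eqVneq r 3.
  by rewrite r3 in tr t'r; rewrite (extra_leaves4 tr tb) (extra_leaves4 t'r t'b').
by rewrite !andbT; case: (b) (b') => -[].
Qed.

Lemma card_le_option n (P : Type) : [set: 'I_n] #<= [set: P] ->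
  [set: 'I_n.+1] #<= [set: option P].
Proof.
move=> /card_leP/injfunPex [h _ hI].
pose f i : P := val (h (SigSub (mem_set (I : [set: 'I_n] i)))).
have fI : injective f by move=> i j /val_inj /hI; rewrite !inE => /(_ I I) [].
pose u (i : 'I_n.+1) := if unlift ord0 i is Some j then Some (f j) else None.
apply: card_le_trans (subset_card_le (subsetT (range u))).
suff /card_range_inj : injective u by rewrite card_eq_le => /andP[].
move=> i j; rewrite /u; case: unliftP => [i' ->|->]; case: unliftP => [j' ->|->] //.
by move=> [] /fI ->.
Qed.

(** * Levels of sets without forks *)

Section Levels.
Variables (K : Type) (lt : K -> K -> Prop).
Hypothesis ltwo : strict_well_order lt.
Implicit Types (S X : set (set K)) (x y z : set K) (d e : K) (t : tree).
Local Notation fdiff := (fdiff lt).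
Local Notation fork := (fork lt).
Local Notation rep := (rep lt).

Definition levels S : set K := [set d | exists x y, [/\ S x, S y & fdiff d x y]].

(* [d] is the last level at which [x] branches off from a point of [X]. *)
Definition top X d x := (exists2 y, X y & fdiff d x y) /\
  (forall y e, X y -> fdiff e x y -> ~ lt d e).

(** Branching after [e] keeps [x'] on the side of [x] and [y'] on the side of [y]. *)
Lemma fork_intro X e x y d x' d' y' : X x -> X x' -> X y -> X y' ->
  fdiff e x y -> fdiff d x x' -> fdiff d' y y' -> lt e d -> lt e d' -> fork X.
Proof.
wlog xe : x y d x' d' y' / ~ x e => [wl|].
  move=> Xx Xx' Xy Xy' [xy xye] xx' yy' ed ed'; have [xe|xe] := pselect (x e).
    apply: (wl y x d' y' d x') => // [ye|].
      by apply: xye; apply/propext.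
    by apply: fdiff_sym.
  by apply: (wl x y d x' d' y').
move=> Xx Xx' Xy Xy' [xy xye] [xx' n1] [yy' n2] ed ed'.
have ye : y e by apply: contrapT => ye; apply: xye; apply/propext.
have tr := lt_trans ltwo.
exists e, x, x', y, y'; split=> //.
- by move=> h; apply: n1; rewrite h.
- by move=> h; apply: n2; rewrite h.
- have axx' : agree lt e x x' by move=> f fe; apply: xx'; apply: tr ed.
  split=> // f fe; rewrite xy // yy' //; exact: tr ed'.
- by rewrite -(xx' e ed) -(yy' e ed').
Qed.

Lemma fdiff3 d x y z : fdiff d x y -> fdiff d x z -> fdiff d y z -> False.
Proof.
move=> [_ xy] [_ xz] [_ yz].
have [xd|xd] := pselect (x d); have [yd|yd] := pselect (y d);
  have [zd|zd] := pselect (z d);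
  by [apply: xy; apply/propext|apply: xz; apply/propext|apply: yz; apply/propext].
Qed.

Lemma fdiff_irr d x : ~ fdiff d x x.
Proof. by move=> []. Qed.

(** Before [d] both agree with [z]; at [d] both differ from it, and there are only two values. *)
Lemma fdiff_close d x y z : fdiff d z x -> fdiff d z y -> x <> y ->
  exists2 e, lt d e & fdiff e x y.
Proof.
move=> zx zy /(fdiff_ex ltwo) [e xy]; exists e => //.
have [ed|ed|//] := lt_total ltwo e d.
- case: xy zx zy => _ n [zx _] [zy _]; case: n.
  by rewrite -zx // zy.
- by subst e; case: (fdiff3 zx zy xy).
Qed.

Lemma top_uniq X d e x : top X d x -> top X e x -> d = e.
Proof.
move=> [[y Xy xy] h] [[z Xz xz] k].
by have [de|//|ed] := lt_total ltwo d e; [case: (h z e)|case: (k y d)].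
Qed.

(** A later branching of [x] and [y] contradicts [top]; an earlier one gives a fork, since both
    branch again at [d]. *)
Lemma top_fdiff X d x y : ~ fork X -> X x -> X y -> top X d x -> top X d y ->
  x <> y -> fdiff d x y.
Proof.
move=> nf Xx Xy [[x' Xx' xx'] tx] [[y' Xy' yy'] ty] /(fdiff_ex ltwo) [e xy].
have [ed|ed|de] := lt_total ltwo e d; last by case: (tx y e).
- by case: nf; apply: (fork_intro Xx Xx' Xy Xy' xy xx' yy').
- by subst e.
Qed.

(** Thus without forks, a last level common to two points is the greatest last level. *)
Lemma top_pair_fork X d d' x x' y : X x -> X x' -> X y -> x <> x' ->
  top X d x -> top X d x' -> top X d' y -> lt d d' -> fork X.
Proof.
move=> Xx Xx' Xy nx tx tx' ty dd'; apply: contrapT => nf.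
have xx' := top_fdiff nf Xx Xx' tx tx' nx.
case: ty => -[y' Xy' yy'] ty.
have xy : x <> y by move=> e; subst y; case: tx => _ /(_ y' d' Xy' yy').
have x'y : x' <> y by move=> e; subst y; case: tx' => _ /(_ y' d' Xy' yy').
have [e xye] := fdiff_ex ltwo xy.
have [ed|ed|ed] := lt_total ltwo e d.
- apply: nf; apply: (fork_intro Xx Xx' Xy Xy' xye xx' yy') => //.
  exact: (lt_trans ltwo) dd'.
- subst e; have [e de x'ye] := fdiff_close xx' xye x'y.
  by case: tx' => _ /(_ y e Xy x'ye).
- by case: tx => _ /(_ y e Xy xye).
Qed.

(** Take for [p] a point without last level if there is one (two would give a fork), otherwise one
    of two points with a common last level, if any. *)
Lemma top_except X : ~ fork X -> X !=set0 -> exists p, [/\ X p,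
  forall x, X x -> x <> p -> exists d, top X d x &
  forall x y d, X x -> X y -> x <> p -> y <> p -> top X d x -> top X d y -> x = y].
Proof.
move=> nf X0.
have [[p Xp pn]|all_top] := pselect (exists2 p, X p & ~ exists d, top X d p).
  have deeper q : X q -> ~ (exists d, top X d q) -> forall y e, X y -> fdiff e q y ->
      exists d z, [/\ X z, fdiff d q z & lt e d].
    move=> Xq qn y e Xy qy; apply: contrapT => h; apply: qn; exists e.
    split; first by exists y.
    by move=> z d Xz qz ed; apply: h; exists d, z.
  exists p; split=> // [x Xx xp|x y d Xx Xy xp yp tx ty].
    apply: contrapT => xn; have [e xpe] := fdiff_ex ltwo xp.
    have [d [z [Xz xz ed]]] := deeper x Xx xn _ _ Xp xpe.
    have [d' [z' [Xz' pz ed']]] := deeper p Xp pn _ _ Xx (fdiff_sym xpe).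
    exact: nf (fork_intro Xx Xz Xp Xz' xpe xz pz ed ed').
  apply: contrapT => xy; have xyd := top_fdiff nf Xx Xy tx ty xy.
  have [e xpe] := fdiff_ex ltwo xp.
  have [ed|ed|ed] := lt_total ltwo e d.
  - have [d' [z' [Xz' pz ed']]] := deeper p Xp pn _ _ Xx (fdiff_sym xpe).
    exact: nf (fork_intro Xx Xy Xp Xz' xpe xyd pz ed ed').
  - subst e; have [e de ype] := fdiff_close xyd xpe yp.
    by case: ty => _ /(_ p e Xp ype).
  - by case: tx => _ /(_ p e Xp xpe).
have topX x : X x -> exists d, top X d x.
  by move=> Xx; apply: contrapT => h; apply: all_top; exists x.
(* A further pair avoiding [p] would have the same last level, but three points cannot pairwise
   differ at one level. *)
have [[d [x [p [Xx Xp xp tx tp]]]]|npair] := pselect (exists d x p,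
    [/\ X x, X p, x <> p, top X d x & top X d p]).
  exists p; split=> // [y Xy _|y z d' Xy Xz yp zp ty tz]; first exact: topX.
  apply: contrapT => yz; have [dd|dd|dd] := lt_total ltwo d d'.
  - exact: nf (top_pair_fork Xx Xp Xy xp tx tp ty dd).
  - subst d'; apply: (@fdiff3 d y z p); apply: (top_fdiff nf) => //; exact/nesym.
  - exact: nf (top_pair_fork Xy Xz Xx yz ty tz tx dd).
have [p Xp] := X0; exists p; split=> // [y Xy _|y z d Xy Xz _ _ ty tz]; first exact: topX.
by apply: contrapT => yz; apply: npair; exists d, y, z.
Qed.

Lemma r_set_max n (E : set K) : r_set n.+1 E ->
  exists2 d, E d & forall e, E e -> ~ lt d e.
Proof.
rewrite /r_set card_eq_sym -(card_eqr card_II).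
elim: n E => [|n IH] E /eq_cardSP [d Ed]; case: (ltwo) => irr _ _ _.
  move=> /card_esym; rewrite (_ : `I_0 = set0); last by rewrite -subset0 => i.
  rewrite card_eq_sym card_eq0 => /eqP E0; exists d => // e Ee.
  have [->|ed] := pselect (e = d); first exact: irr.
  by have : (E `\ d) e by []; rewrite E0.
move=> /IH [e [Ee ed] emax]; have [ed'|ed'] := pselect (lt e d).
  exists d => // c Ec dc; have [cd|cd] := pselect (c = d); first by subst c; case: (irr d).
  exact: (emax c (conj Ec cd) (lt_trans ltwo ed' dc)).
exists e => // c Ec ec; have [cd|cd] := pselect (c = d); first by subst c.
exact: (emax c (conj Ec cd) ec).
Qed.

(** Take a point [s d] with last level [d] for each [d] in [E], and one point [y] from which that of
    the greatest level branches off there. Two points [s d], [s e] branch at the smaller level, and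
    [s d] branches from [y] at [d]. *)
Lemma levels_realize X r (E : set K) : ~ fork X -> r_set r.+1 E ->
  (forall d, E d -> exists2 x, X x & top X d x) ->
  exists S, [/\ S `<=` X, r_set r.+2 S & levels S = E].
Proof.
move=> nf rE Etop; have [d0 Ed0 d0max] := r_set_max rE.
(* [set0] is a junk value for levels outside [E]. *)
have /choice [s sP] d : exists x, E d -> X x /\ top X d x.
  have [/Etop [x Xx tx]|nE] := pselect (E d); last by exists set0.
  by exists x.
have Xs d : E d -> X (s d) by case/sP.
have ts d : E d -> top X d (s d) by case/sP.
have [[y Xy y0] _] := ts _ Ed0.
have s_lt d e : E d -> E e -> lt d e -> fdiff d (s d) (s e).
  move=> Ed Ee de; have [[x' Xx' xx'] tx] := ts _ Ed; have [[z' Xz' zz'] tz] := ts _ Ee.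
  have [|c xz] := @fdiff_ex _ _ ltwo (s d) (s e).
    by move=> e'; move: zz'; rewrite -e' => zz'; apply: (tx z' e).
  have [cd|cd|cd] := lt_total ltwo c d.
  - case: nf; apply: (fork_intro (Xs _ Ed) Xx' (Xs _ Ee) Xz' xz xx' zz') => //.
    exact: (lt_trans ltwo) de.
  - by subst c.
  - by case: (tx _ _ (Xs _ Ee) xz).
have s_y d : E d -> fdiff d (s d) y.
  move=> Ed; have [dd|<-//|dd] := lt_total ltwo d0 d; first by case: (d0max d).
  have [] := (s_lt _ _ Ed Ed0 dd); case: y0 => y0 _ ag n; split; last by rewrite -y0.
  by move=> f fd; rewrite ag // y0 //; apply: (lt_trans ltwo) dd.
exists ([set y] `|` s @` E); split.
- by move=> x [->|[d Ed <-]] //; exact: Xs.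
- apply: (@r_setU _ 1) => [x -> [d Ed e]||].
  + by apply: (@fdiff_irr d y); rewrite -{1}e; apply: s_y.
  + exact: r_set1.
  + apply: card_eq_trans rE (card_esym (inj_card_eq _)) => d e.
    rewrite !inE => Ed Ee de; apply: (top_uniq (ts _ Ed)); rewrite de; exact: ts.
- apply/seteqP; split=> [d|d Ed]; last first.
    by exists (s d), y; split; [right; exists d|left|exact: s_y].
  move=> [x [z [[->|[a Ea <-]] [->|[b Eb <-]] xz]]].
  + by case: (fdiff_irr xz).
  + by rewrite (fdiff_uniq ltwo xz (fdiff_sym (s_y _ Eb))).
  + by rewrite (fdiff_uniq ltwo xz (s_y _ Ea)).
  + have [ab|ab|ab] := lt_total ltwo a b.
    * by rewrite (fdiff_uniq ltwo xz (s_lt _ _ Ea Eb ab)).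
    * by subst b; case: (fdiff_irr xz).
    * by rewrite (fdiff_uniq ltwo xz (fdiff_sym (s_lt _ _ Eb Ea ab))).
Qed.

(** [Y] consists of the last levels of all points but the exceptional one, whose loss takes the size
    from lambda+1 to lambda. *)
Lemma nofork_levels X (P : Type) : ~ fork X -> X #= [set: option P] ->
  exists Y : set K, Y #= [set: P] /\
    forall r E, E `<=` Y -> r_set r.+1 E ->
      exists S, [/\ S `<=` X, r_set r.+2 S & levels S = E].
Proof.
move=> nf /card_eq_range [h hI hX].
have Xh o : X (h o) by rewrite -hX; exists o.
have [|p [Xp ptop pinj]] := top_except nf; first by exists (h None).
(* [k] enumerates X minus p: it is [h \o Some] with [p] replaced by [h None]. *)
pose k l := if pselect (h (Some l) = p) is left _ then h None else h (Some l).
have kX l : X (k l) by rewrite /k; case: pselect.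
have kp l : k l <> p.
  by rewrite /k; case: pselect => // <- /hI.
have kI : injective k.
  move=> a b; rewrite /k; case: pselect => ap; case: pselect => bp.
  - by move: bp; rewrite -ap => /hI [].
  - by move=> /hI.
  - by move=> /hI.
  - by move=> /hI [].
have /choice [m mP] l : exists d, top X d (k l) by apply: ptop.
have mI : injective m.
  move=> a b ab; apply: kI; apply: (pinj _ _ (m a)) => //; rewrite ab; exact: mP.
exists (range m); split=> [|r E EY rE]; first exact: card_range_inj.
by apply: levels_realize rE _ => // d /EY [l _ <-]; exists (k l).
Qed.

(* Junk value [None] on sets with no tree, i.e. infinite or empty ones. *)
Definition extra_of S : option bool :=
  if pselect (exists t, rep S t) is left h then extra (projT1 (cid h)) else None.

Lemma extra_ofE S t : rep S t -> extra_of S = extra t.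
Proof.
rewrite /extra_of => rS; case: pselect => [h|[]]; last by exists t.
by case: cid => t' /= rS'; rewrite (rep_uniq ltwo rS' rS).
Qed.

Lemma extra_of_nofork S : ~ fork S -> extra_of S = None.
Proof.
rewrite /extra_of => nf; case: pselect => // h; case: cid => t rS /=.
by case e: extra => //; case/extra_some: e => _ /(rep_core_fork rS).
Qed.

End Levels.

(** * The colouring and its verification *)

Theorem theoremA1 (r : nat) (K : Type) (T : Type) (L : T -> Type) :
  3 <= r ->
  inhabited K ->
  inhabited T ->
  (forall xi : T, [set: 'I_r.+1] #<= [set: L xi]) ->
  neg_arrow K r L ->
  neg_arrow (set K) r.+1 (concl_sizes r L (eta r)).
Proof.
move=> r3 _ _ Lr [f fP]; have [lt ltwo] := strict_well_order_ex K.
pose g (S : set (set K)) : T + 'I_(eta r) :=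
  if extra_of lt S is Some b then inr (extra_index r b) else inl (f (levels lt S)).
exists g => c X Xc mono.
(* For the colours of [T] this holds because lambda is at least r+1. *)
have Xr : [set: 'I_r.+2] #<= X.
  rewrite (card_le_eqr Xc); case: c {mono Xc} => [xi|j] /=; last exact: card_lexx.
  exact: card_le_option.
have gE S t : rep lt S t -> S `<=` X -> leaves t = r.+1 ->
    (if extra t is Some b then inr (extra_index r b) else inl (f (levels lt S))) = c.
  move=> rS SX tr; rewrite -(extra_ofE ltwo rS); apply: mono => //.
  by rewrite -tr; apply: rep_card rS.
(* Otherwise two deletions would lie in different classes, although both have colour [c]. *)
have twin Y t : rep lt Y t -> Y `<=` X -> leaves t = r.+2 -> leaves (core t) <= 1.
  move=> rY YX tr; rewrite leqNgt; apply/negP => ct.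
  have [|t1 [t2 [d1 d2 ne]]] := extra_del ct; first by rewrite tr.
  have [[Y1 YY1 r1] [Y2 YY2 r2]] := (rep_del d1 rY, rep_del d2 rY).
  have [l1 l2] : leaves t1 = r.+1 /\ leaves t2 = r.+1.
    by have := (del_leaves d1, del_leaves d2); rewrite tr => -[[->] [->]].
  have := gE _ _ r1 (subset_trans YY1 YX) l1; have := gE _ _ r2 (subset_trans YY2 YX) l2.
  case e1: (extra t1) ne => [b1|]; case e2: (extra t2) => [b2|] // ne <- // [] e.
  by case: ne; congr Some; apply: extra_index_inj l1 l2 e1 e2 _; apply/val_inj; rewrite /= e.
(* A fork would extend to r+2 points of [X] whose tree is not a comb. *)
have nfX : ~ fork lt X.
  move=> /(fork_rep4 ltwo) [S [t [fS SX rS t4]]].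
  have t4r : leaves t <= r.+2 by rewrite t4 !ltnS ltnW.
  have [Y [u [SY YX rY ur]]] := rep_grow ltwo rS SX t4r Xr.
  have := twin Y u rY YX ur; rewrite leqNgt => /negP; apply.
  apply: (rep_fork_core ltwo rY).
  move: fS => [d [x1 [x2 [y1 [y2 [[h1 h2 h3 h4] ? ? ? ?]]]]]].
  by exists d, x1, x2, y1, y2; split=> //; split; apply: SY.
have gX S : S `<=` X -> r_set r.+1 S -> inl (f (levels lt S)) = c.
  move=> SX rS; rewrite -(mono S SX rS) /g extra_of_nofork //.
  move=> [d [x1 [x2 [y1 [y2 [[h1 h2 h3 h4] ? ? ? ?]]]]]]; apply: nfX.
  by exists d, x1, x2, y1, y2; split=> //; split; apply: SX.
case: c Xc {mono twin gE} gX => [xi|j] /= Xc gX.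
  have [Y [YL Yreal]] := nofork_levels ltwo nfX Xc.
  apply: (fP xi Y YL) => E EY rE; have r0 : r = r.-1.+1 by case: (r) r3.
  rewrite r0 in rE; have [S [SX rS <-]] := Yreal _ _ EY rE; rewrite -r0 in rS.
  by have [] := gX S SX rS.
(* In an extra colour, [X] has r+2 points; any r+1 of them form a set coloured through [f], a
   contradiction. *)
have [h hI hX] := card_eq_range Xc.
suff [S SX rS] : exists2 S, S `<=` X & r_set r.+1 S by have := gX S SX rS.
exists (range (h \o widen_ord (leqnSn _))).
  by move=> _ [i _ <-]; rewrite -hX; exists (widen_ord (leqnSn _) i).
apply: card_esym; apply: card_range_inj => a b /hI /(congr1 val) /= ab; exact: val_inj.
Qed.
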